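(* Let $p>1$ and let $G=(V,E)$ be a finite connected graph with vertex measure $\mu$ and symmetric edge measure $\omega$. Let $h\in C(V)$ satisfy $h\le 0$ on $V$ and $h\not\equiv 0$. Then $c_-(h)=-\infty$, and hence for every constant $c<0$ the equation $$\Delta_p u=c-he^{u}\quad\text{in } V$$ has a solution $u\in C(V)$.
   Context: $G=(V,E)$ is a finite connected graph with vertex set $V$ and edge set $E$; $i\sim j$ means that $i,j\in V$ are joined by an edge. $\mu:V\to(0,+\infty)$ is a fixed vertex measure and $\omega:E\to(0,+\infty)$ is a fixed edge measure, symmetric: $\omega_{ij}=\omega_{ji}$ for each edge $i\sim j$. $C(V)$ is the finite-dimensional vector space of all real functions on $V$. For $p>1$ the discrete $p$-Laplacian $\Delta_p:C(V)\to C(V)$ is $$\Delta_p f_i=\frac{1}{\mu_i}\sum_{j\sim i}\omega_{ij}|f_j-f_i|^{p-2}(f_j-f_i),\qquad i\in V,$$ where $|t|^{p-2}t$ is understood to be $0$ at $t=0$. For $h\in C(V)$ with $\sum_{i\in V}\mu_i h_i<0$, $c_-(h)$ denotes the (unique) element of $[-\infty,0)$ such that the equation $\Delta_p u=c-he^{u}$ in $V$ has a solution for every $c\in(c_-(h),0)$ but has no solution for any real $c<c_-(h)$. *)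

(* Defs.v *)
From mathcomp Require Import all_boot all_order all_algebra.
From mathcomp Require Import boolp classical_sets reals constructive_ereal sequences exp.

Set Implicit Arguments.
Unset Strict Implicit.
Unset Printing Implicit Defensive.

Import Order.TTheory GRing.Theory Num.Theory.

Local Open Scope classical_set_scope.
Local Open Scope ring_scope.

(* The graph has vertex type [V] and adjacency relation [e]; the edge measure
   is a function [w] on pairs of vertices, only its values on edges matter.
   The factor [f j - f i] makes the summand vanish when [f j = f i], whatever
   the value of [0 `^ (p - 2)]. *)
Definition plaplacian (R : realType) (V : finType) (e : rel V)
    (mu : V -> R) (w : V -> V -> R) (p : R) (f : V -> R) (i : V) : R :=
  (mu i)^-1 *
  \sum_(j | e i j) w i j * (`|f j - f i| `^ (p - 2) * (f j - f i)).

Definition is_solution (R : realType) (V : finType) (e : rel V)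
    (mu : V -> R) (w : V -> V -> R) (p : R) (h : V -> R) (c : R)
    (u : V -> R) : Prop :=
  forall i, plaplacian e mu w p u i = c - h i * expR (u i).

Definition solvable (R : realType) (V : finType) (e : rel V)
    (mu : V -> R) (w : V -> V -> R) (p : R) (h : V -> R) (c : R) : Prop :=
  exists u : V -> R, is_solution e mu w p h c u.

Definition is_c_minus (R : realType) (V : finType) (e : rel V)
    (mu : V -> R) (w : V -> V -> R) (p : R) (h : V -> R) (x : \bar R) : Prop :=
  [/\ (x < 0)%E,
      forall c : R, (x < c%:E)%E -> c < 0 -> solvable e mu w p h c &
      forall c : R, (c%:E < x)%E -> ~ solvable e mu w p h c].

(* The element of [-oo, 0[ satisfying [is_c_minus], unique by
   [is_c_minus_unique]. The default value 0 lies outside that range, so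
   [c_minus = x] with [x < 0] implies [is_c_minus x]. *)
Definition c_minus (R : realType) (V : finType) (e : rel V)
    (mu : V -> R) (w : V -> V -> R) (p : R) (h : V -> R) : \bar R :=
  xget 0%E [set x | is_c_minus e mu w p h x].

Lemma is_c_minus_unique (R : realType) (V : finType) (e : rel V)
    (mu : V -> R) (w : V -> V -> R) (p : R) (h : V -> R) (x y : \bar R) :
  is_c_minus e mu w p h x -> is_c_minus e mu w p h y -> x = y.
Proof.
wlog xy : x y / (x < y)%E => [wl Hx Hy|[_ Hx _] [y0 _ Hy]].
  case: (ltgtP x y) => // [/wl|/wl]; first exact.
  by move=> /(_ Hy Hx).
have [c xc cy] : exists2 c : R, (x < c%:E)%E & (c%:E < y)%E.
  case: x y xy y0 {Hx Hy} => [r| |] [s| |] //.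
  - rewrite lte_fin => rs _; exists ((r + s) / 2);
      by rewrite lte_fin ?midf_lt.
  - move=> _ _; exists (s - 1); first exact: ltNyr.
    by rewrite lte_fin ltrBlDr ltrDl ltr01.
exfalso; apply: (Hy c cy); apply: Hx => //.
by rewrite -lte_fin; apply: lt_trans cy y0.
Qed.

(* Main.v *)
Require Import Defs.
From mathcomp Require Import all_boot all_order all_algebra.
From mathcomp Require Import boolp classical_sets reals constructive_ereal sequences exp.
From mathcomp Require Import topology normedtype lra.

Set Implicit Arguments.
Unset Strict Implicit.
Unset Printing Implicit Defensive.

Import Order.TTheory GRing.Theory Num.Theory.
Import numFieldNormedType.Exports.

Local Open Scope ring_scope.

(** Writing [phi t = |t|^(p-2) t] and [F i t = mu i * (c - h i * e^t)], the
    equation at [i] reads [\sum_(j ~ i) w i j * phi (u j - u i) = F i (u i)].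
    Its left side is nondecreasing in the values [u j] off [i], so Perron's
    method applies: the pointwise supremum of all subsolutions is a solution
    as soon as subsolutions exist and are uniformly bounded above.

    Since [c < 0], a very negative constant is a subsolution
    ([subsolution_exists]). For the upper bound, let a subsolution [s] attain
    its maximum at [m]. Its net inflow is bounded below at every vertex, by
    [mu i * c], and no inflow can be large where [s] is close to its maximum;
    hence [s] cannot drop much along an edge, and following a path bounds
    [s m - s i0] independently of [s], for [i0] a vertex with [h i0 < 0]
    ([subsolution_drop]). The inflow at [i0] is then bounded above, so
    [- h i0 * e^(s i0)] is too, which bounds [s i0] and therefore [s m]
    ([subsolution_max_bounded]).

    Of [phi] only three properties matter: it is nondecreasing, onto, and
    vanishes at 0. Solvability for every [c < 0] makes [-oo] satisfy the
    characterization of [c_minus]. *)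

(** * Perron's method for a monotone flux on a connected graph *)

Lemma nondecreasing_surj_continuous (R : realType) (f : R -> R) :
  {homo f : x y / x <= y} -> (forall y, exists x, f x = y) -> continuous f.
Proof.
move=> f_homo f_surj x; apply/cvgrPdist_le => eps eps_gt0.
have [a fa] := f_surj (f x - eps); have [b fb] := f_surj (f x + eps).
have ax : a < x by rewrite ltNge; apply/negP => /f_homo; lra.
have xb : x < b by rewrite ltNge; apply/negP => /f_homo; lra.
near=> y.
have ay : a <= y by apply: ltW; near: y; exact: lt_nbhsr.
have yb : y <= b by apply: ltW; near: y; exact: lt_nbhsl.
have := f_homo _ _ ay; have := f_homo _ _ yb; rewrite fa fb => ? ?.
by rewrite ler_distl; apply/andP; split; lra.
Unshelve. all: by end_near. Qed.

Section Perron.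

Context (R : realType) (V : finType) (e : rel V) (w : V -> V -> R).
Context (phi : R -> R) (F : V -> R -> R) (i0 : V).
Hypothesis e_connected : forall i j, connect e i j.
Hypothesis w_gt0 : forall i j, e i j -> 0 < w i j.
Hypothesis phi_homo : {homo phi : x y / x <= y}.
Hypothesis phi_surj : forall y, exists x, phi x = y.
Hypothesis phi0 : phi 0 = 0.
Hypothesis F_cont : forall i, continuous (F i).
Hypothesis F_lower : exists b, forall i t, b <= F i t.
Hypothesis F_neg : exists t, forall i, F i t <= 0.
Hypothesis F_coercive : forall a, exists b, forall t, F i0 t <= a -> t <= b.

(** The net balance at [i] when the value there is [t] and the other values
    are those of [u]: inflow from the neighbours minus reaction. A loop at
    [i] carries no flux and is left out, so that [t] and [u] off [i] are
    independent. *)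
Definition balance (i : V) (u : V -> R) (t : R) : R :=
  \sum_(j | e i j && (j != i)) w i j * phi (u j - t) - F i t.

(** Inflow is at least the reaction at every vertex; solutions are the
    functions for which equality holds everywhere. *)
Definition subsolution (u : V -> R) := forall i, 0 <= balance i u (u i).

Lemma balance_le (i : V) (u v : V -> R) (t : R) :
  (forall j, j != i -> u j <= v j) -> balance i u t <= balance i v t.
Proof.
move=> uv; rewrite lerD2r; apply: ler_sum => j /andP[eij ji].
by rewrite ler_wpM2l ?(ltW (w_gt0 eij))// phi_homo// lerD2r uv.
Qed.

Lemma balance_continuous (i : V) (u : V -> R) : continuous (balance i u).
Proof.
have phi_cont := nondecreasing_surj_continuous phi_homo phi_surj.
move=> t; apply: cvgB; last exact: F_cont.
apply: cvg_big => [|j _]; first by move=> x; exact: add_continuous.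
apply: cvgMl_tmp; apply: continuous_comp; last exact: phi_cont.
by apply: cvgB; [exact: cvg_cst|exact: cvg_id].
Qed.

(** The bound [C] depends on [m] and [l] only. At a vertex lying at most [C]
    below the maximum, the inflow from each neighbour is at most
    [w * phi C], so a nonnegative balance limits the outflow along any one
    edge, hence the further drop along it. *)
Lemma subsolution_drop (m l : V) :
  exists2 C, 0 <= C & forall s, subsolution s -> (forall r, s r <= s m) ->
    s m - s l <= C.
Proof.
have /connectP[p + ->] := e_connected m l.
elim/last_ind: p => [_|p q IH]; first by exists 0 => //= s _ _; rewrite subrr.
rewrite rcons_path last_rcons; set k := last m p.
move=> /andP[/IH[C C0 dropC] ekq].
have [->|qk] := eqVneq q k; first by exists C.
have [b F_ge] := F_lower.
pose A := \sum_(j | e k j && (j != k)) w k j * phi C - b.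
(* If [s q - s k <= D], the outflow to [q] outweighs every other term. *)
have [D phiD] := phi_surj (- (A / w k q) - 1).
exists (C + `|D|) => [|s sub_s max_m]; first by rewrite addr_ge0.
have wkq := w_gt0 ekq.
suff : D <= s q - s k.
  have := ler_norm (- D); rewrite normrN; have := dropC s sub_s max_m; lra.
rewrite leNgt; apply/negP => /ltW/phi_homo; rewrite phiD => phi_q.
have := sub_s k; rewrite /balance leNgt => /negP; apply.
have kq : e k q && (q != k) by rewrite ekq.
rewrite (bigD1 q)//=.
have rest : \sum_(j | e k j && (j != k) && (j != q)) w k j * phi (s j - s k)
    <= \sum_(j | e k j && (j != k) && (j != q)) w k j * phi C.
  apply: ler_sum => j /andP[/andP[ekj _] _].
  rewrite ler_wpM2l ?(ltW (w_gt0 ekj))// phi_homo//.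
  by have := dropC s sub_s max_m; have := max_m j; lra.
have sumC : w k q * phi C
    + \sum_(j | e k j && (j != k) && (j != q)) w k j * phi C = A + b.
  by rewrite /A subrK [RHS](bigD1 q).
have phiC : 0 <= w k q * phi C by rewrite mulr_ge0 ?(ltW wkq)// -phi0 phi_homo.
have : w k q * phi (s q - s k) <= - A - w k q.
  apply: le_trans (ler_wpM2l (ltW wkq) phi_q) _.
  by rewrite mulrBr mulr1 mulrN mulrCA mulfV ?gt_eqF// mulr1.
have := F_ge k (s k); lra.
Qed.

Lemma subsolution_max_bounded (m : V) :
  exists M, forall s, subsolution s -> (forall r, s r <= s m) -> s m <= M.
Proof.
have [C _ drop] := subsolution_drop m i0.
have [b F_le] := F_coercive (\sum_(j | e i0 j && (j != i0)) w i0 j * phi C).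
exists (b + C) => s sub_s max_m; have dropm := drop s sub_s max_m.
suff /F_le : F i0 (s i0) <= \sum_(j | e i0 j && (j != i0)) w i0 j * phi C by lra.
have := sub_s i0; rewrite /balance subr_ge0 => /le_trans; apply.
apply: ler_sum => j /andP[eij _].
rewrite ler_wpM2l ?(ltW (w_gt0 eij))// phi_homo//.
by have := max_m j; lra.
Qed.

Lemma subsolutions_bounded :
  exists M, forall s, subsolution s -> forall i, s i <= M.
Proof.
have [M Mmax] := choice subsolution_max_bounded.
exists (\sum_m `|M m|) => s sub_s i.
have [m _ max_m] := @arg_maxP _ _ _ i0 xpredT s isT.
apply: le_trans (max_m i isT) _.
apply: le_trans (Mmax m s sub_s (fun r => max_m r isT)) _.
by rewrite (bigD1 m)//= (le_trans (ler_norm _))// lerDl sumr_ge0.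
Qed.

Lemma subsolution_exists : exists s, subsolution s.
Proof.
have [t F_le0] := F_neg; exists (fun=> t) => i.
rewrite /balance subrr phi0 big1 => [|j _]; last by rewrite mulr0.
by rewrite sub0r oppr_ge0.
Qed.

(** The supremum [u] of all subsolutions is a subsolution by continuity and
    monotonicity of the balance. Where its balance were positive, raising [u]
    slightly at that vertex would give a larger subsolution. *)
Lemma perron_solution : exists u : V -> R,
  forall i, \sum_(j | e i j) w i j * phi (u j - u i) = F i (u i).
Proof.
have [s0 sub_s0] := subsolution_exists; have [M s_le] := subsolutions_bounded.
pose vals i := [set t | exists2 s, subsolution s & t = s i]%classic.
have vals_sup i : has_sup (vals i).
  by split; [exists (s0 i), s0|exists M => t [s sub_s ->]; exact: s_le].
pose u i := sup (vals i).
have le_u s i : subsolution s -> s i <= u i.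
  by move=> sub_s; apply: sup_upper_bound => //; exists s.
have sub_u : subsolution u.
  move=> i; rewrite leNgt; apply/negP => neg.
  have /nbhs_ballP[d /= d0 negd] : (\forall t \near u i, balance i u t < 0)%classic.
    exact: cvgr_lt (@balance_continuous i u (u i)) _ neg.
  have [_ [s sub_s ->] lt_s] := sup_adherent d0 (vals_sup i).
  have : balance i u (s i) < 0.
    apply: negd; rewrite /ball /= ger0_norm ?subr_ge0 ?le_u//.
    by rewrite ltrBlDr -ltrBlDl.
  rewrite ltNge => /negP; apply; apply: le_trans (sub_s i) _.
  by apply: balance_le => j _; exact: le_u.
exists u => i; have [pos|] := ltP 0 (balance i u (u i)).
  have /nbhs_ballP[d /= d0 posd] : (\forall t \near u i, 0 < balance i u t)%classic.
    exact: cvgr_gt (@balance_continuous i u (u i)) _ pos.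
  pose v j := if j == i then u i + d / 2 else u j.
  have vi : v i = u i + d / 2 by rewrite /v eqxx.
  have uv j : u j <= v j.
    by rewrite /v; case: eqP => // ->; rewrite lerDl divr_ge0// ltW.
  suff /le_u - /(_ i) : subsolution v by rewrite vi; lra.
  move=> k; have [->|ki] := eqVneq k i.
    apply: (@le_trans _ _ (balance i u (v i))); last exact: balance_le.
    apply/ltW/posd; rewrite /ball /= vi opprD addrA subrr sub0r normrN.
    by rewrite ger0_norm; lra.
  have -> : v k = u k by rewrite /v (negPf ki).
  by apply: le_trans (sub_u k) _; exact: balance_le.
move=> le0; have /eqP : balance i u (u i) = 0.
  by apply: le_anti; rewrite le0 sub_u.
rewrite /balance subr_eq0 => /eqP <-.
rewrite (bigID (fun j => j != i))/= [X in _ + X]big1 ?addr0//.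
by move=> j /andP[_ /negPn/eqP ->]; rewrite subrr phi0 mulr0.
Qed.

End Perron.

(** * The flux of the discrete p-Laplacian *)

(** The flux [t |-> |t|^(p-2) t] of the discrete [p]-Laplacian. *)
Definition pflux (R : realType) (p t : R) : R := `|t| `^ (p - 2) * t.

Section PFlux.

Context (R : realType) (p : R).
Hypothesis p_gt1 : 1 < p.

Lemma pflux0 : pflux p 0 = 0.
Proof. by rewrite /pflux mulr0. Qed.

Lemma pfluxN t : pflux p (- t) = - pflux p t.
Proof. by rewrite /pflux normrN mulrN. Qed.

Lemma ge0_pflux t : 0 <= t -> pflux p t = t `^ (p - 1).
Proof.
rewrite le_eqVlt => /predU1P[<-|t0].
  by rewrite pflux0 powR0// subr_eq0 gt_eqF.
rewrite /pflux gtr0_norm// mulrC; have -> : p - 2 = p - 1 - 1 by lra.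
by rewrite mulr_powRB1 ?subr_gt0// ltW.
Qed.

Lemma pflux_homo : {homo pflux p : x y / x <= y}.
Proof.
have p1 : 0 <= p - 1 by rewrite subr_ge0 ltW.
have nonneg x y : 0 <= x -> x <= y -> pflux p x <= pflux p y.
  move=> x0 xy; rewrite !ge0_pflux ?(le_trans x0)//.
  by apply: ge0_ler_powR; rewrite ?nnegrE// (le_trans x0).
move=> x y xy; have [x0|/ltW x0] := leP 0 x; first exact: nonneg.
have [y0|/ltW y0] := leP 0 y.
  apply: (@le_trans _ _ 0); last by rewrite -pflux0 nonneg.
  by rewrite -oppr_ge0 -pfluxN -pflux0 nonneg// oppr_ge0.
by rewrite -lerN2 -!pfluxN nonneg ?oppr_ge0// lerN2.
Qed.

Lemma pflux_surj y : exists x, pflux p x = y.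
Proof.
wlog y0 : y / 0 <= y => [surj|].
  have [/surj//|/ltW y0] := leP 0 y.
  have [|x px] := surj (- y); first by rewrite oppr_ge0.
  by exists (- x); rewrite pfluxN px opprK.
exists (y `^ (p - 1)^-1); rewrite ge0_pflux ?powR_ge0// -powRrM mulVf ?powRr1//.
by rewrite subr_eq0 gt_eqF.
Qed.

End PFlux.

(** * Solvability for negative constants *)

Lemma solvable_neg (R : realType) (V : finType) (e : rel V)
    (mu : V -> R) (w : V -> V -> R) (p : R) (h : V -> R) (c : R) :
  (forall i j, connect e i j) -> (forall i, 0 < mu i) ->
  (forall i j, e i j -> 0 < w i j) -> 1 < p ->
  (forall i, h i <= 0) -> (exists i, h i <> 0) -> c < 0 ->
  solvable e mu w p h c.
Proof.
move=> e_connected mu_gt0 w_gt0 p_gt1 h_le0 [i0 /eqP hi0] c_lt0.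
have h_exp i t : 0 <= - (h i * expR t).
  by rewrite oppr_ge0 mulr_le0_ge0 ?expR_ge0.
pose F i t := mu i * (c - h i * expR t).
have F_cont i : continuous (F i).
  move=> t; apply: cvgMl_tmp; apply: cvgB; first exact: cvg_cst.
  by apply: cvgMl_tmp; exact: continuous_expR.
have F_lower : exists b, forall i t, b <= F i t.
  exists (\sum_i mu i * c) => i t; apply: (@le_trans _ _ (mu i * c)).
    rewrite (bigD1 i)//= gerDl sumr_le0// => j _.
    by rewrite pmulr_rle0 ?mu_gt0// ltW.
  by rewrite ler_pM2l ?mu_gt0// lerDl.
have F_neg : exists t, forall i, F i t <= 0.
  pose K := \sum_i `|h i|; have K0 : 0 <= K by exact: sumr_ge0.
  (* [t] solves [(K + 1) * e^t = - c], and [K + 1] exceeds every [- h i]. *)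
  exists (ln (- c / (K + 1))) => i; rewrite pmulr_rle0 ?mu_gt0//.
  have K1 : 0 < K + 1 by lra.
  have eK : 0 < - c / (K + 1) by rewrite divr_gt0// oppr_gt0.
  rewrite lnK ?posrE//.
  have hK : - h i <= K + 1.
    have : `|h i| <= K by rewrite /K (bigD1 i)//= lerDl sumr_ge0.
    by rewrite ler0_norm//; lra.
  have : - h i * (- c / (K + 1)) <= (K + 1) * (- c / (K + 1)).
    by rewrite ler_wpM2r// ltW.
  by rewrite [leRHS]mulrCA mulfV ?gt_eqF// mulr1; lra.
have F_coercive a : exists b, forall t, F i0 t <= a -> t <= b.
  have h0 : 0 < - h i0 by rewrite oppr_gt0 lt_neqAle hi0 h_le0.
  (* [F i0 t <= a] bounds [e^t] by this number, and [t <= e^t]. *)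
  exists ((a / mu i0 - c) / - h i0) => t.
  rewrite /F mulrC -ler_pdivlMr ?mu_gt0// => Fa.
  rewrite ler_pdivlMr//.
  have : t * - h i0 <= expR t * - h i0.
    by rewrite ler_wpM2r ?(ltW h0)//; have := expR_ge1Dx t; lra.
  lra.
have [u sol_u] := perron_solution e_connected w_gt0 (pflux_homo p_gt1)
  (pflux_surj p_gt1) (pflux0 p) F_cont F_lower F_neg F_coercive.
exists u => i; rewrite /plaplacian.
have -> : \sum_(j | e i j) w i j * (`|u j - u i| `^ (p - 2) * (u j - u i))
    = F i (u i) by exact: sol_u.
by rewrite mulKf// gt_eqF.
Qed.

Theorem theorem2p6 (R : realType) (V : finType) (e : rel V)
    (e_sym : symmetric e)
    (e_connected : forall i j : V, connect e i j)
    (mu : V -> R) (mu_gt0 : forall i, 0 < mu i)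
    (w : V -> V -> R) (w_gt0 : forall i j, e i j -> 0 < w i j)
    (w_sym : forall i j, e i j -> w i j = w j i)
    (p : R) (p_gt1 : 1 < p)
    (h : V -> R) (h_le0 : forall i, h i <= 0) (h_neq0 : exists i, h i <> 0) :
  c_minus e mu w p h = (-oo)%E /\
  (forall c : R, c < 0 -> exists u : V -> R, is_solution e mu w p h c u).
Proof.
have solv c : c < 0 -> solvable e mu w p h c by exact: solvable_neg.
have minusoo : is_c_minus e mu w p h -oo%E.
  split=> [|c _|c]; first exact: ltNyr; first exact: solv.
  by rewrite ltNge leNye.
split=> //; apply: xget_unique => // y minus_y.
exact: is_c_minus_unique minus_y minusoo.
Qed.
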